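(* Let $G$ be a finite group satisfying $|\mathrm{Sup}(G)| = 2$. Then either $G \cong S_3$ or $G$ is a real simple group. In particular, if $G$ is solvable and $|\mathrm{Sup}(G)| = 2$, then $G$ is either $\mathbb{Z}_3$ or $S_3$ (up to isomorphism).
   Context: For a finite group $G$, $\mathrm{Irr}(G)$ denotes the set of irreducible complex characters of $G$. A supercharacter theory of $G$ is a pair $(\mathcal{X}, \mathcal{K})$ where $\mathcal{X}$ is a partition of $\mathrm{Irr}(G)$ and $\mathcal{K}$ is a partition of $G$ such that: (1) $|\mathcal{X}| = |\mathcal{K}|$; (2) for each $X \in \mathcal{X}$ there exists a character $\chi_X$ of $G$ whose irreducible constituents lie in $X$ such that $\chi_X$ is constant on the members of $\mathcal{K}$; (3) $\{1\} \in \mathcal{K}$. $\mathrm{Sup}(G)$ denotes the set of all supercharacter theories of $G$. A group $G$ is a real group if all the characters in $\mathrm{Irr}(G)$ are real valued. A simple group is a nontrivial group with no proper nontrivial normal subgroups (it may be abelian). $\mathbb{Z}_3$ is the cyclic group of order 3 and $S_3$ is the symmetric group on 3 letters.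
   Formalization: The first sentence fails for G = Z_3, which has exactly two supercharacter theories but is neither S_3 nor a real group; the formal theorem therefore adds the alternative G ≅ Z_3 to the first conclusion. *)

(* Defs.v *)
From HB Require Import structures.
From mathcomp Require Import all_boot all_order all_fingroup all_algebra.
From mathcomp Require Import all_solvable all_field all_character.
From mathcomp Require Import boolp.

Set Implicit Arguments.
Unset Strict Implicit.
Unset Printing Implicit Defensive.

Local Open Scope group_scope.

(* Irr(G) is represented by the index type [Iirr G], in bijection with the    *)
(* irreducible complex characters through [i |-> 'chi_i].  MathComp counts    *)
(* the zero class function as a character, hence the condition [chi != 0].   *)
Definition supercharacter_theory (gT : finGroupType) (G : {group gT})
    (XX : {set {set Iirr G}}) (KK : {set {set gT}}) : Prop :=
  [/\ partition XX [set: Iirr G], partition KK G, #|XX| = #|KK|,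
      forall X, X \in XX ->
        exists chi : 'CF(G),
          [/\ chi \is a character, chi != 0%R,
              {subset irr_constt chi <= X}
            & forall K, K \in KK -> {in K &, forall x y, chi x = chi y}]
    & [set 1] \in KK].

Definition Sup (gT : finGroupType) (G : {group gT}) :
    {set {set {set Iirr G}} * {set {set gT}}} :=
  [set T | `[< supercharacter_theory T.1 T.2 >]].

Definition real_group (gT : finGroupType) (G : {group gT}) : Prop :=
  forall (i : Iirr G) (x : gT), x \in G -> ('chi[G]_i x)%R \is Num.real.

(* Main.v *)
(* The conjugacy classes, the partition {1}, G \ 1, the partition            *)
(* {1}, N \ 1, G \ N for N normal in G, and the unions of K and K^-1 over    *)
(* the classes K all come from supercharacter theories; in the last case the  *)
(* partitions have equal sizes by Brauer's count of the real irreducible      *)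
(* characters.  If there are only two theories, the third and the fourth must *)
(* each agree with the first or the second.  A nontrivial proper N then makes *)
(* N \ 1 and G \ N classes, and divisibility of |G| by their sizes forces     *)
(* |G| = 6.  If x and x^-1 are not conjugate, their classes make up G \ 1 and *)
(* have a common size dividing |G|, so |G| = 3.                               *)

Require Import Defs.
From mathcomp Require Import all_boot all_order all_fingroup all_algebra.
From mathcomp Require Import all_solvable all_field all_character.
From mathcomp Require Import boolp zify.

Set Implicit Arguments.
Unset Strict Implicit.
Unset Printing Implicit Defensive.

Import Order.TTheory GRing.Theory Num.Theory.

Local Open Scope group_scope.

(** The argument is a pigeonhole on partitions of the group. [superclass_mapI] turns a map on [G]
    and a map on the irreducible characters into a supercharacter theory. It yields theories for the
    classes ([superclass_map_class]), for a normal subgroup ([superclass_map_normal]) and for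
    classes merged with their inverses ([superclass_map_conjC]). When [Sup G] has two elements,
    [Sup2_eq_fibers] makes two of any three such partitions equal. In the non-real and non-simple
    cases the only coincidence that survives determines the classes of [G], and
    [isog_Z3_of_class_pair] and [isog_S3_of_three_classes] finish by divisibility. A solvable simple
    group has prime order; if its elements are also conjugate to their inverses, it has order 2,
    which [Sup_le1] excludes. *)

(** * Partitions into fibers and orbits of involutions *)

Lemma card_preim_partition (T rT : finType) (f : T -> rT) (D : {set T}) :
  #|preim_partition f D| = #|f @: D|.
Proof.
rewrite /preim_partition /equivalence_partition.
pose F (a : rT) := [set y in D | a == f y].
have -> : [set [set y in D | f x == f y] | x in D] = F @: (f @: D).
  by rewrite -imset_comp.
apply: card_in_imset => _ _ /imsetP[x Dx ->] /imsetP[y Dy ->] /setP/(_ x).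
by rewrite !inE Dx eqxx /= => /esym/eqP->.
Qed.

Lemma eq_preim_partition (T rT1 rT2 : finType) (f : T -> rT1)
    (h : T -> rT2) (D : {set T}) :
  preim_partition f D = preim_partition h D ->
  {in D &, forall x y, (f x == f y) = (h x == h y)}.
Proof.
have E (rT : finType) (k : T -> rT) x y : x \in D -> y \in D ->
    (y \in pblock (preim_partition k D) x) = (k x == k y).
  move=> Dx Dy; apply: (@pblock_equivalence_partition _ _ D) => //.
  by split=> // /eqP->.
by move=> eqP x y Dx Dy; rewrite -!E // eqP.
Qed.

(** Give [x] the weight 2 if [s] fixes it and 1 otherwise: every orbit then has total weight 2. *)
Lemma card_involution_orbits (T : finType) (s : T -> T) (D : {set T}) :
    involutive s -> {in D, forall x, s x \in D} ->
  (#|[set [set x; s x] | x in D]|).*2 = #|D| + #|[set x in D | s x == x]|.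
Proof.
move=> sK sD; pose h x := [set x; s x].
have -> : #|D| + #|[set x in D | s x == x]| = \sum_(x in D) (1 + (s x == x)).
  rewrite big_split /= sum1_card; congr (_ + _).
  by rewrite -sum1dep_card big_mkcondr; apply: eq_bigr => x _; case: eqP.
rewrite (partition_big_imset h) /= -muln2 -sum_nat_const.
apply: eq_bigr => _ /imsetP[x Dx ->].
have hE y : (y \in D) && (h y == h x) = (y \in [set x; s x]).
  rewrite !inE; apply/andP/orP => [[_ /eqP/setP/(_ y)]|[] /eqP->].
  - by rewrite !inE eqxx => /esym/orP.
  - by rewrite Dx eqxx.
  - by rewrite sD // /h sK setUC eqxx.
rewrite (eq_bigl _ _ hE); have [fx|nfx] := eqVneq (s x) x.
  by rewrite fx setUid big_set1 fx eqxx.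
by rewrite big_setU1 ?inE ?(eq_sym x) //= big_set1 sK (negPf nfx) eq_sym (negPf nfx).
Qed.

(** The map [pblock P] sends [D] onto the blocks, so the bound on the sizes makes it injective. The
    fibers of [id] are the singletons. *)
Lemma partition_singletons (T : finType) (P : {set {set T}}) (D : {set T}) :
  partition P D -> #|D| <= #|P| -> P = preim_partition id D.
Proof.
move=> pP leDP; have defP := preim_partition_pblock pP.
have /imset_injP injP : #|pblock P @: D| == #|D|.
  by rewrite eqn_leq leq_imset_card -card_preim_partition defP.
rewrite -[LHS]defP; apply: eq_in_imset => x Dx; apply/setP => y; rewrite !inE.
case: (boolP (y \in D)) => //= Dy.
by apply/eqP/eqP => [/injP->|->].
Qed.

(** * Supercharacter theories whose superclasses are the fibers of a map *)

Section SuperclassMaps.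

Local Open Scope ring_scope.
Local Open Scope group_scope.

Variables (gT : finGroupType) (G : {group gT}).

(** The character partition stays existential, since theories are told apart below by their
    superclasses alone. *)
Definition superclass_map (rT : finType) (f : gT -> rT) : Prop :=
  exists XX : {set {set Iirr G}},
    supercharacter_theory XX (preim_partition f G).

(* A fiber [X] of [g] is given the character [sum_(j in X) chi_j(1) chi_j].   *)
Lemma superclass_mapI (rT sT : finType) (f : gT -> rT) (g : Iirr G -> sT) :
    {in G, forall x, f x = f 1 -> x = 1} ->
    #|f @: G| = #|g @: [set: Iirr G]| ->
    (forall i, {in G &, forall x y, f x = f y ->
      (\sum_(j | g j == g i) 'chi_j 1%g * 'chi_j x)%R
      = (\sum_(j | g j == g i) 'chi_j 1%g * 'chi_j y)%R}) ->
  superclass_map f.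
Proof.
move=> f1 cardfg constf; exists (preim_partition g setT); split.
- exact: preim_partitionP.
- exact: preim_partitionP.
- by rewrite !card_preim_partition.
- move=> _ /imsetP[i _ ->].
  pose chi := (\sum_(j | g j == g i) 'chi[G]_j 1%g *: 'chi_j)%R.
  (* The multiplicity of ['chi_k] in [chi] is its degree on the fiber of [i] and zero elsewhere,
     which gives both [chi != 0] and the location of the constituents. *)
  have chiE k : ('[chi, 'chi_k] = 'chi_k 1%g *+ (g k == g i))%R.
    rewrite cfdot_suml (eq_bigr (fun j => if j == k then 'chi[G]_k 1%g else 0%R)); last first.
      by move=> j _; rewrite cfdotZl cfdot_irr; case: eqP => [->|]; rewrite ?mulr1 ?mulr0.
    rewrite -big_mkcondr; case: eqP => gk.
      rewrite (big_pred1 k) // => j /=; rewrite andbC; case: eqP => // ->.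
      exact/eqP.
    by rewrite big_pred0 // => j; apply/negP => /andP[/eqP + /eqP jk]; rewrite jk.
  have i_chi : i \in irr_constt chi by rewrite irr_consttE chiE eqxx irr1_neq0.
  exists chi; split.
  + by apply: rpred_sum => j _; have /natrP[n ->] := Cnat_irr1 j; rewrite scaler_nat rpredMn ?irr_char.
  + by apply/eqP => chi0; move: i_chi; rewrite chi0 irr_consttE cfdot0l eqxx.
  + move=> k; rewrite irr_consttE chiE !inE [g i == _]eq_sym.
    by case: (g k == g i) => //; rewrite mulr0n eqxx.
  + move=> _ /imsetP[x Gx ->] y z; rewrite !inE.
    case/andP=> Gy /eqP fy /andP[Gz /eqP fz]; rewrite /chi !sum_cfunE.
    under eq_bigr do rewrite cfunE; under [RHS]eq_bigr do rewrite cfunE.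
    by apply: constf; rewrite // -fy -fz.
- apply/imsetP; exists 1; rewrite ?group1 //; apply/setP=> x; rewrite !inE.
  apply/eqP/andP=> [->|[Gx /eqP fx]]; first by rewrite group1.
  by apply: f1.
Qed.

(** Three pairwise distinct partitions of [G] would give three distinct theories, whatever character
    partitions accompany them. *)
Lemma Sup2_eq_fibers (rT1 rT2 rT3 : finType)
    (f1 : gT -> rT1) (f2 : gT -> rT2) (f3 : gT -> rT3) :
    #|Sup G| = 2%N ->
    superclass_map f1 -> superclass_map f2 -> superclass_map f3 ->
  [\/ {in G &, forall x y, (f1 x == f1 y) = (f2 x == f2 y)},
      {in G &, forall x y, (f1 x == f1 y) = (f3 x == f3 y)}
    | {in G &, forall x y, (f2 x == f2 y) = (f3 x == f3 y)}].
Proof.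
move=> sup2 [X1 sct1] [X2 sct2] [X3 sct3].
pose T1 := (X1, preim_partition f1 G); pose T2 := (X2, preim_partition f2 G).
pose T3 := (X3, preim_partition f3 G).
have [/eq_preim_partition e12 | /eqP n12] := eqVneq T1.2 T2.2.
  by constructor 1.
have [/eq_preim_partition e13 | /eqP n13] := eqVneq T1.2 T3.2.
  by constructor 2.
have [/eq_preim_partition e23 | /eqP n23] := eqVneq T2.2 T3.2.
  by constructor 3.
have sub : T1 |: [set T2; T3] \subset Sup G.
  by apply/subsetP=> T; rewrite !inE => /or3P[]/eqP->; apply/asboolP.
move: (subset_leq_card sub); rewrite sup2 cardsU1 cards2 !inE.
have -> : T1 == T2 = false by apply/eqP => e; apply: n12; rewrite e.
have -> : T1 == T3 = false by apply/eqP => e; apply: n13; rewrite e.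
by have -> : T2 == T3 = false by apply/eqP => e; apply: n23; rewrite e.
Qed.

Lemma superclass_map_class : superclass_map (fun x => x ^: G).
Proof.
apply: (@superclass_mapI _ _ _ id).
- by move=> x Gx ec; have:= class_refl G x; rewrite ec class1G => /set1P.
- by rewrite imset_id cardsT card_ord NirrE.
- move=> i x y Gx Gy ec; have:= class_refl G x; rewrite ec => /imsetP[z Gz ->].
  by apply: eq_bigr => j _; rewrite cfunJ.
Qed.

(** The irreducible characters with [N] in their kernel are those lifted from [G / N], so the sum is
    the regular character of [G / N] at the coset of [x]. *)
Lemma sum_irr_quo (N : {group gT}) x : N <| G -> x \in G ->
  (\sum_(j | N \subset cfker 'chi[G]_j) 'chi_j 1%g * 'chi_j x)%R
  = (#|(G / N)%g|%:R *+ (x \in N))%R.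
Proof.
move=> nsNG Gx.
rewrite (reindex _ (mod_Iirr_bij nsNG)) /=.
rewrite (eq_big predT (fun i => ('chi_i 1%g *: 'chi[G / N]_i) (coset N x))%R).
- rewrite -sum_cfunE -cfReg_sum cfRegE; congr (_ *+ _)%R.
  congr nat_of_bool; apply/eqP/idP => [cx|/coset_id//].
  by apply/coset_idr => //; apply: subsetP Gx; apply: normal_norm.
- by move=> i; rewrite mod_IirrE ?cfker_mod.
by move=> i _; rewrite mod_IirrE // cfunE !cfModE // morph1.
Qed.

(** The characters are split into the principal one, the others with [N] in their kernel, and the
    rest. With [SN] and [S] the degree-weighted sums over the characters of [G / N] and of [G], the
    three blocks have sums 1, [SN - 1] and [S - SN]. The cases [N = 1] and [N = G], where a block is
    empty, are covered too. *)
Lemma superclass_map_normal (N : {group gT}) : N <| G ->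
  superclass_map (fun x => (x == 1, x \in N)).
Proof.
move=> nsNG; have [sNG nNG] := andP nsNG; pose f x := (x == 1, x \in N).
pose g (i : Iirr G) := (i == 0%R, (i == 0%R) || ~~ (N \subset cfker 'chi_i)).
apply: (@superclass_mapI _ _ _ g).
- by move=> x _ [] x1 _; apply/eqP; rewrite x1 eqxx.
- rewrite -/f; suffices -> : f @: G = g @: [set: Iirr G] by [].
  (* The images agree value by value: [(true, true)] always occurs and [(true, false)] never. On
     both sides [(false, true)] occurs iff [N] is nontrivial, as the kernels meet in 1, and
     [(false, false)] iff [N] is proper, as the kernels containing [N] meet in [N]. *)
  apply/setP; case=> a b; case: a; case: b.
  + transitivity true; first by apply/imsetP; exists 1; rewrite // /f eqxx group1.
    by apply/esym/imsetP; exists 0%R; rewrite // /g eqxx.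
  + transitivity false; first by apply/imsetP=> -[x _ []] /esym/eqP-> /esym; rewrite group1.
    by apply/esym/imsetP=> -[i _ []] <-.
  + transitivity (N :!=: 1).
      apply/imsetP/trivgPn => [[x Gx []] x1 Nx | [x Nx x1]].
        by exists x; rewrite -?x1 -?Nx.
      by exists x; rewrite ?(subsetP sNG) // /f Nx (negPf x1).
    rewrite -subG1 -(TI_cfker_irr G); apply/idP/imsetP => [N1|[i _ []] <- /= Ni].
      have /existsP[i Ni] : [exists i : Iirr G, ~~ (N \subset cfker 'chi_i)].
        apply: contraR N1; rewrite negb_exists => /forallP Nall.
        by apply/bigcapsP => i _; have:= Nall i; rewrite negbK.
      exists i; rewrite // /g (negPf Ni) orbT.
      by case: eqP Ni => // ->; rewrite cfker_irr0 sNG.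
    by apply: contra (esym Ni) => /subset_trans-> //; apply: bigcap_inf.
  + transitivity (~~ (G \subset N)).
      apply/imsetP/subsetPn => [[x Gx []] _ Nx | [x Gx Nx]].
        by exists x; rewrite -?Nx.
      exists x; rewrite // /f (negPf Nx).
      by case: eqP Nx => // ->; rewrite group1.
    apply/idP/imsetP => [NG|[i _ []] i0]; last first.
      rewrite -i0 /= => /esym/negbFE Ni; apply: contraFN (esym i0) => GN.
      by rewrite -subGcfker (subset_trans GN).
    have /existsP[i /andP[i0 Ni]] :
        [exists i : Iirr G, (i != 0%R) && (N \subset cfker 'chi_i)].
      apply: contraR NG; rewrite negb_exists => /forallP Nall.
      rewrite -(cap_cfker_normal nsNG); apply/bigcapsP => i Ni.
      by have:= Nall i; rewrite Ni andbT negbK => /eqP->; rewrite cfker_irr0.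
    by exists i; rewrite // /g Ni (negPf i0).
- move=> i x y Gx Gy [] x1 xN.
  pose S z := (\sum_j 'chi[G]_j 1%g * 'chi_j z)%R.
  pose SN z := (\sum_(j | N \subset cfker 'chi[G]_j) 'chi_j 1%g * 'chi_j z)%R.
  have eS : S x = S y.
    have SE z : S z = (#|G|%:R *+ (z == 1%g))%R.
      rewrite -cfRegE cfReg_sum sum_cfunE.
      by under [RHS]eq_bigr do rewrite cfunE.
    by rewrite !SE x1.
  have eSN : SN x = SN y by rewrite /SN !sum_irr_quo // xN.
  have e0 : 'chi[G]_0%R x = 'chi[G]_0%R y by rewrite irr0 !cfun1E Gx Gy.
  have [->|i0] := eqVneq i 0%R.
    have gE j : (g j == g 0%R) = (j == 0%R).
      by rewrite /g eqxx xpair_eqE eqb_id; case: (j == 0%R).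
    by rewrite !(big_pred1 0%R) ?e0.
  case: (boolP (N \subset cfker 'chi_i)) => Ni.
    have gE j : (g j == g i) = (N \subset cfker 'chi_j) && (j != 0%R).
      by rewrite /g xpair_eqE (negPf i0) Ni; case: (j == 0%R); case: (N \subset _).
    rewrite !(eq_bigl _ _ gE); move: eSN.
    rewrite /SN (bigD1 0%R) ?cfker_irr0 //= e0 [in RHS](bigD1 0%R) ?cfker_irr0 //=.
    exact: addrI.
  have gE j : (g j == g i) = ~~ (N \subset cfker 'chi_j).
    rewrite /g xpair_eqE (negPf i0) (negPf Ni).
    have [->|_] := eqVneq j 0%R.
      by rewrite cfker_irr0 sNG.
    by case: (N \subset _).
  rewrite !(eq_bigl _ _ gE); move: eS.
  rewrite /S (bigID (fun j => N \subset cfker 'chi_j)) /= -/(SN x) eSN.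
  rewrite [in RHS](bigID (fun j => N \subset cfker 'chi_j)) /= -/(SN y).
  exact: addrI.
Qed.

(** A double count: multiplied by the order of [G], both sides equal the sum of
    ['chi_i x * ('chi_i x^-1)^*] over all [x] and [i]. Summing over [x] first uses the first
    orthogonality relation, over [i] first the second. *)
Lemma card_real_irr_classes :
  #|[set i : Iirr G | conjC_Iirr i == i]| = #|[set K in classes G | K^-1 == K]|.
Proof.
have nzG : #|G|%:R != 0%R :> algC by rewrite pnatr_eq0 -lt0n cardG_gt0.
apply/eqP; rewrite -(eqr_nat algC) -(inj_eq (mulfI nzG)); apply/eqP.
transitivity (\sum_(x in G) \sum_i 'chi[G]_i x * ('chi_i x^-1%g)^*)%R.
  rewrite exchange_big /= -sum1dep_card natr_sum mulr_sumr big_mkcond /=.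
  apply: eq_bigr => i _.
  transitivity (#|G|%:R * '[ 'chi_i, 'chi_(conjC_Iirr i)])%R.
    by rewrite cfdot_irr eq_sym; case: eqP => _; rewrite ?mulr1 ?mulr0.
  rewrite cfdotE mulrA divff // mul1r; apply: eq_bigr => x Gx.
  by rewrite conjC_IirrE cfunE irr_inv.
have E x : x \in G -> (\sum_i 'chi[G]_i x * ('chi_i x^-1%g)^*
    = #|'C_G[x]%g|%:R *+ ((x ^: G)^-1 == x ^: G)%g)%R.
  move=> Gx; rewrite second_orthogonality_relation ?groupV //.
  congr (_ *+ nat_of_bool _)%R; rewrite -classVg.
  apply/idP/eqP => [/class_eqP-> //|->]; exact: class_refl.
rewrite sum_by_classes => [|x y Gx Gy]; last first.
  by under eq_bigr do rewrite -conjVg !cfunJ //.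
rewrite -sum1dep_card natr_sum mulr_sumr.
rewrite big_mkcondr /=; apply: eq_bigr => K clK.
have /repr_classesP[Gx defK] := clK.
(* A class closed under inversion contributes its size times the order of a centralizer, which is
   the order of [G]. *)
rewrite E // -defK -(Lagrange (subcent1_sub (repr K) G)) index_cent1 -defK natrM.
by case: eqP => _; rewrite ?mulr1 ?mulr0 // mulrC.
Qed.

(** Each irreducible character is grouped with its complex conjugate. Inversion on classes and
    conjugation on characters act on sets of equal size with equally many fixed points, hence have
    equally many orbits. *)
Lemma superclass_map_conjC : superclass_map (fun x => [set x ^: G; (x ^: G)^-1]).
Proof.
pose h (K : {set gT}) := [set K; K^-1].
pose g (i : Iirr G) := [set i; conjC_Iirr i].
have gC i : g (conjC_Iirr i) = g i by rewrite /g conjC_IirrK setUC.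
apply: (@superclass_mapI _ _ _ g).
- move=> x Gx /setP/(_ (x ^: G)); rewrite class1G invg_set1 invg1 !inE eqxx /=.
  by rewrite orbb => /esym/eqP/eqP; rewrite classG_eq1 => /eqP.
- rewrite (imset_comp h (fun x => x ^: G)) -/(classes G).
  apply: double_inj; rewrite !card_involution_orbits //.
  + rewrite -card_real_irr_classes -NirrE; congr (_ + _)%N.
      by rewrite cardsT card_ord.
    by apply: eq_card => i; rewrite !inE.
  + exact: conjC_IirrK.
  + exact: invgK.
  + by move=> _ /imsetP[x Gx ->]; rewrite -classVg mem_classes ?groupV.
- move=> i x y Gx Gy /setP/(_ (y ^: G)); rewrite !inE eqxx /= => xy.
  have {xy} : (y \in x ^: G) || (y \in x^-1 ^: G).
    by move: xy; rewrite -classVg => /orP[]/eqP <-; rewrite class_refl ?orbT.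
  case/orP => /imsetP[z Gz ->]; first by apply: eq_bigr => j _; rewrite cfunJ.
  (* Here [y] is conjugate to the inverse of [x]; complex conjugation permutes the fiber and absorbs
     the inversion. *)
  rewrite (reindex_inj (inv_inj (@conjC_IirrK _ G))) /=.
  apply: eq_big => j; first by rewrite gC.
  rewrite conjC_IirrE !cfunE cfunJ // irr_inv => _; congr (_ * _)%R.
  exact: conj_natr (Cnat_irr1 j).
Qed.

Lemma Sup_le1 : (#|G| <= 2)%N -> (#|Sup G| <= 1)%N.
Proof.
move=> G2; apply/card_le1_eqP => -[X1 K1] [X2 K2].
rewrite !inE => /asboolP[/= pX1 pK1 c1 _ o1] /asboolP[/= pX2 pK2 c2 _ o2].
(* With fewer blocks than the at most two elements of [G], the only block is the trivial one, so [G]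
   has one element, a contradiction. *)
have cardK (K : {set {set gT}}) : partition K G -> [set 1] \in K -> (#|G| <= #|K|)%N.
  move=> pK o; rewrite leqNgt; apply/negP => ltKG.
  have defK : K = [set [set 1]].
    apply/eqP; rewrite eq_sym eqEcard sub1set o cards1.
    by rewrite -ltnS (leq_trans ltKG).
  have oG : #|G| = 1%N.
    by have [/eqP <- _ _] := and3P pK; rewrite defK /cover big_set1 cards1.
  by move: ltKG; rewrite defK cards1 oG.
have cardX (K : {set {set gT}}) : (#|G| <= #|K|)%N -> (#|[set: Iirr G]| <= #|K|)%N.
  by apply: leq_trans; rewrite cardsT card_ord NirrE leq_imset_card.
rewrite (partition_singletons pK1 (cardK _ pK1 o1)).
rewrite (partition_singletons pK2 (cardK _ pK2 o2)).
rewrite (partition_singletons pX1) ?c1 ?cardX ?cardK //.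
by rewrite (partition_singletons pX2) ?c2 ?cardX ?cardK.
Qed.

End SuperclassMaps.

(** * Recognizing the symmetric group by two involutions *)

(** Two distinct involutions generate a dihedral subgroup; its order is even, exceeds 2 and divides
    6. *)
Lemma isog_dihedral6 (gT : finGroupType) (G : {group gT}) x y :
    #|G| = 6 -> x \in G -> y \in G -> #[x] = 2 -> #[y] = 2 -> x != y ->
  G \isog [set: 'D_6].
Proof.
move=> oG Gx Gy ox oy nxy; pose H := <<[set x; y]>>%G.
have sHG : H \subset G by rewrite gen_subG subUset !sub1set Gx Gy.
have x1 : x != 1 by rewrite -order_eq1 ox.
have y1 : y != 1 by rewrite -order_eq1 oy.
have H3 : 2 < #|H|.
  have : 1 |: [set x; y] \subset H.
    by rewrite subUset sub1set group1 subset_gen.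
  by move/subset_leq_card; rewrite cardsU1 cards2 !inE nxy !(eq_sym 1) (negPf x1) (negPf y1).
have H2 : 2 %| #|H| by rewrite -ox order_dvdG // mem_gen // set21.
have H6 : #|H| %| 6 by rewrite -oG cardSg.
have oH : #|H| = 6.
  have := dvdn_leq (isT : 0 < 6) H6.
  by move: H3 H2 H6; case: #|H| => [|[|[|[|[|[|[|]]]]]]].
have -> : G :=: H by apply/esym/eqP; rewrite eqEcard sHG oG oH.
by rewrite -oH; apply: involutions_gen_dihedral.
Qed.

(** Two transpositions show that ['S_3] is dihedral of order 6 as well. *)
Lemma isog_S3 (gT : finGroupType) (G : {group gT}) x y :
    #|G| = 6 -> x \in G -> y \in G -> #[x] = 2 -> #[y] = 2 -> x != y ->
  G \isog [set: 'S_3].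
Proof.
move=> oG Gx Gy ox oy nxy; apply: isog_trans (isog_dihedral6 oG Gx Gy ox oy nxy) _.
pose a : 'I_3 := @Ordinal 3 0 isT; pose b : 'I_3 := @Ordinal 3 1 isT.
pose c : 'I_3 := @Ordinal 3 2 isT.
have o2 (u v : 'I_3) : u != v -> #[tperm u v] = 2.
  move=> nuv; apply: nt_prime_order => //; first exact: tperm2.
  by apply: contraNneq nuv => /permP/(_ u); rewrite tpermL perm1 => ->.
rewrite isog_sym (@isog_dihedral6 _ _ (tperm a b) (tperm a c)) ?inE //.
- by rewrite cardsT card_Sn.
- exact: o2.
- exact: o2.
- by apply/eqP => /permP/(_ a); rewrite !tpermL.
Qed.

(** * Groups with prescribed conjugacy classes *)

Section ConjugacyClasses.

Variables (gT : finGroupType) (G : {group gT}).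

(** The nontrivial classes are [N^#] and [G :\: N]. With [n] the order and [k] the index of [N],
    both [n - 1] and [n (k - 1)] divide [n k], so [k = 2], and [n - 1] divides 2 because it is
    coprime to [n]. *)
Lemma isog_S3_of_three_classes (N : {group gT}) :
    N <| G -> N :!=: 1 -> N :!=: G ->
    {in G &, forall x y,
      (x ^: G == y ^: G) = ((x == 1, x \in N) == (y == 1, y \in N))} ->
  G \isog [set: 'S_3].
Proof.
move=> nsNG N1 NG clE; have [sNG nNG] := andP nsNG.
have [x Nx x1] := trivgPn _ N1.
have /subsetPn[y Gy Ny] : ~~ (G \subset N).
  by move: NG; rewrite eqEsubset sNG.
have Gx := subsetP sNG x Nx.
have y1 : y != 1 by apply: contraNneq Ny => ->.
have mem_cl u v : u \in G -> v \in G -> (v \in u ^: G) = (v ^: G == u ^: G).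
  by move=> Gu Gv; apply/idP/eqP => [/class_eqP//|<-]; apply: class_refl.
have clx : x ^: G = N^#.
  apply/setP => z; rewrite !inE; case: (boolP (z \in G)) => Gz.
    by rewrite mem_cl // clE // Nx (negPf x1) xpair_eqE; case: (z == 1); case: (z \in N).
  rewrite (contraNF (subsetP (class_subG Gx (subxx G)) z)) //.
  by rewrite (contraNF (subsetP sNG z)) ?andbF.
have cly : y ^: G = G :\: N.
  apply/setP => z; rewrite !inE; case: (boolP (z \in G)) => Gz.
    rewrite mem_cl // clE // (negPf Ny) (negPf y1) xpair_eqE.
    by case: (eqVneq z 1) => [->|]; rewrite ?group1 //; case: (z \in N).
  by rewrite (contraNF (subsetP (class_subG Gy (subxx G)) z)) ?andbF.
have dvd_cl z : #|z ^: G| %| #|G| by rewrite -index_cent1 dvdn_indexg.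
have := dvd_cl y; have := dvd_cl x; rewrite clx cly.
have oG := Lagrange sNG.
rewrite [#|G :\: N|]cardsD (setIidPr sNG) -oG.
have -> : #|N^#| = #|N|.-1 by rewrite [in RHS](cardsD1 1 N) group1.
have n2 : 1 < #|N| by rewrite cardG_gt1.
have k2 : 1 < #|G : N| by rewrite indexg_gt1; apply/subsetPn; exists y.
have -> : (#|N| * #|G : N| - #|N| = #|N| * (#|G : N| - 1))%N by rewrite mulnBr muln1.
rewrite dvdn_pmul2l ?cardG_gt0 // => dvx dvy.
have k_eq : #|G : N| = 2.
  have : #|G : N| - 1 %| 1 by rewrite -(dvdn_addr _ (dvdnn _)) subnK // ltnW.
  by rewrite dvdn1 => /eqP; lia.
have n_le : #|N| <= 3.
  have : #|N|.-1 %| 2.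
    rewrite -(@Gauss_dvdr _ #|N|) -?k_eq // /coprime -{2}(prednK (ltnW n2)).
    by rewrite -addn1 gcdnDl gcdn1.
  by move/dvdn_leq; lia.
have [nN2|nN3] : #|N| = 2 \/ #|N| = 3 by lia.
  (* Order 4 makes [G] abelian, against the class [G :\: N] of size 2. *)
  have cG : abelian G by rewrite (@card_p2group_abelian _ 2) // -oG nN2 k_eq.
  have /eqP : #|y ^: G| = 2 by rewrite cly cardsD (setIidPr sNG) -oG nN2 k_eq.
  have /abelian_classP cl1 := cG.
  by rewrite cl1 // cards1.
have oG6 : #|G| = 6 by rewrite -oG nN3 k_eq.
(* An involution lies outside [N], which has order 3; its class has three elements and so supplies a
   second involution. *)
have [t Gt ot] : {t | t \in G & #[t] = 2} by apply: Cauchy; rewrite ?oG6.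
have Nt : t \notin N.
  by apply/negP => /order_dvdG; rewrite ot nN3.
have t_y : y ^: G = t ^: G by apply/esym/class_eqP; rewrite cly !inE Nt.
have ex_u : 1 < #|t ^: G| by rewrite -t_y cly cardsD (setIidPr sNG) oG6 nN3.
have [u tu ut] : exists2 u, u \in t ^: G & u != t.
  have : 0 < #|t ^: G :\ t| by move: ex_u; rewrite (cardsD1 t) class_refl.
  by rewrite card_gt0 => /set0Pn[u /setD1P[ut tu]]; exists u.
have [z Gz uE] := imsetP tu.
by apply: (isog_S3 oG6 Gt (subsetP (class_subG Gt (subxx G)) _ tu) ot _); rewrite 1?eq_sym // uE orderJ.
Qed.

(** The two classes are disjoint of a common size [c], so [G] has order [2c + 1]; since [c] divides
    this, [c = 1]. *)
Lemma isog_Z3_of_class_pair x :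
    x \in G -> x ^: G :|: x^-1 ^: G = G^# -> x^-1 \notin x ^: G ->
  G \isog [set: 'Z_3].
Proof.
move=> Gx defG nx.
have oG : #|G| = (#|x ^: G|).*2.+1.
  rewrite (cardsD1 1) group1 -[G :\ 1]/G^# -defG cardsU disjoint_setI0.
    by rewrite cards0 subn0 classVg card_invg addnn.
  apply/pred0Pn => -[z /andP[/= /class_eqP zx /class_eqP zx']].
  by case/negP: nx; rewrite -zx zx' class_refl.
have : #|x ^: G| %| #|G| by rewrite -index_cent1 dvdn_indexg.
rewrite oG -addn1 dvdn_addr ?dvdn1; last by rewrite -muln2 dvdn_mulr.
move/eqP => c1; rewrite c1 in oG.
by rewrite isog_cyclic_card !(prime_cyclic, cardsT, card_ord, oG).
Qed.

Lemma real_group_inv : {in G, forall x, x^-1 \in x ^: G} -> real_group G.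
Proof.
move=> invG i x Gx; have /imsetP[z Gz xz] := invG x Gx.
by apply/CrealP; rewrite -irr_inv xz cfunJ.
Qed.

End ConjugacyClasses.

(** * The trichotomy and the solvable case *)

Theorem theorem1 (gT : finGroupType) (G : {group gT}) (hG : #|Sup G| = 2) :
  (G \isog [set: 'Z_3]
   \/ G \isog [set: 'S_3]
   \/ (simple G /\ real_group G))
  /\ (solvable G -> G \isog [set: 'Z_3] \/ G \isog [set: 'S_3]).
Proof.
have G3 : 2 < #|G|.
  by rewrite ltnNge; apply/negP => /Sup_le1; rewrite hG.
(* Taking [N = 1] gives the coarsest theory, with superclasses 1 and [G^#]. *)
have smM := superclass_map_normal (normal1 G).
have sm_m := superclass_map_class G.
have mem_class x y : (x \in y ^: G) = (x ^: G == y ^: G).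
  by apply/idP/eqP => [/class_eqP|<-] //; apply: class_refl.
have trichotomy : G \isog [set: 'Z_3] \/ G \isog [set: 'S_3] \/
    simple G /\ {in G, forall x, x^-1 \in x ^: G}.
  have [/forall_inP invG | ] := boolP [forall x in G, x^-1 \in x ^: G]; last first.
    rewrite negb_forall_in => /exists_inP[x Gx nx]; left.
    have Gxi := groupVr Gx.
    have x1 : x != 1 by apply: contraNneq nx => ->; rewrite invg1 class_refl.
    have xi1 : x^-1 != 1 by rewrite invg_eq1.
    apply: (isog_Z3_of_class_pair Gx) => //.
    (* The first and third coincidences would make [x] and its inverse conjugate; the second says
       that their two classes fill [G^#]. *)
    have [eM|eM|em] := Sup2_eq_fibers hG smM sm_m (superclass_map_conjC G).
    - have := eM _ _ Gxi Gx; rewrite -mem_class (negPf nx) !inE.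
      by rewrite (negPf x1) (negPf xi1) eqxx.
    - apply/setP => y; rewrite !inE; case: (boolP (y \in G)) => Gy; last first.
        rewrite andbF; apply: contraNF Gy.
        by case/orP; apply: subsetP; apply: class_subG.
      have := eM _ _ Gx Gy; rewrite xpair_eqE !inE (negPf x1).
      rewrite andbT !mem_class classVg.
      have -> : ([set x ^: G; (x ^: G)^-1] == [set y ^: G; (y ^: G)^-1])
          = (y ^: G == x ^: G) || (y ^: G == (x ^: G)^-1).
        apply/eqP/orP => [/setP/(_ (y ^: G))|[]/eqP-> //].
          by rewrite !inE eqxx => /orP.
        by rewrite invgK setUC.
      by move=> <-; case: (y == 1).
    - have := em _ _ Gxi Gx; rewrite -mem_class (negPf nx).
      by rewrite -!classVg invgK setUC eqxx.
  have [sG | nsG] := boolP (simple G); first by right; right.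
  right; left.
  have G1 : G :!=: 1 by rewrite -cardG_gt1 ltnW.
  have [N nsNG [N1 NG]] : exists2 N : {group gT}, N <| G & N :!=: 1 /\ N :!=: G.
    have [/existsP[N /and3P[]]|] :=
        boolP [exists N : {group gT}, [&& N <| G, N :!=: 1 & N :!=: G]].
      by exists N.
    rewrite negb_exists => /forallP noN; case/negP: nsG; apply/simpleP.
    split=> // N nsNG; have:= noN N; rewrite nsNG /= negb_and !negbK.
    by case/orP => /eqP; [left | right].
  apply: (isog_S3_of_three_classes nsNG N1 NG).
  have [x Nx x1] := trivgPn _ N1; have Gx := subsetP (normal_sub nsNG) x Nx.
  have /subsetPn[y Gy Ny] : ~~ (G \subset N).
    by move: NG; rewrite eqEsubset normal_sub.
  have y1 : y != 1 by apply: contraNneq Ny => ->.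
  (* The first coincidence would make [x] in [N] conjugate to [y] outside [N], and the second would
     put them on the same side of [N]. The third is the goal. *)
  have [eM|eM|//] := Sup2_eq_fibers hG smM sm_m (superclass_map_normal nsNG).
  - have := eM _ _ Gx Gy; rewrite !inE (negPf x1) (negPf y1) eqxx => /esym/eqP ec.
    have := class_refl G y; rewrite -ec => xy; case/negP: Ny; apply: subsetP xy.
    by rewrite class_sub_norm ?normal_norm.
  - have := eM _ _ Gx Gy; rewrite !inE (negPf x1) (negPf y1) eqxx.
    by rewrite Nx (negPf Ny).
split.
  case: trichotomy => [|[|[sG invG]]]; auto.
  by right; right; split=> //; apply: real_group_inv.
move=> solG; case: trichotomy => [|[|[sG invG]]]; auto.
have pG := simple_sol_prime solG sG.
have [x Gx x1] : exists2 x, x \in G & x != 1 by apply/trivgPn; rewrite -cardG_gt1 ltnW.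
have /abelian_classP cl1 := cyclic_abelian (prime_cyclic pG).
have := invG x Gx; rewrite cl1 // inE => /eqP xi.
(* In an abelian group, being conjugate to its inverse makes [x] an involution, but a nontrivial
   element has the prime order of [G], which exceeds 2. *)
have : #[x] %| 2 by rewrite order_dvdn expgS expg1 -{1}xi mulVg.
move/dvdn_leq => /(_ isT); rewrite leqNgt; case/negP.
have /primeP[_ /(_ _ (order_dvdG Gx))] := pG.
by rewrite order_eq1 (negPf x1) => /eqP->.
Qed.
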